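(* Let $m\ge 1$, $0\le r\le m-1$, $s=\gcd(m,r)$ (with $\gcd(m,0)=m$) and $p=m/s$. Then $$R_{m,r}(x,y,q)=\frac{1}{1-\sum\limits_{j=1}^s\sum\limits_{\ell=0}^{p-1}\sum\limits_{i=0}^{p-1}\dfrac{x^{\overline{j+(i+\ell)r}}\,y^{i+1}(q-1)^i\prod_{k=\ell}^{i+\ell-1}x^{\overline{j+kr}}}{(1-x^m)^{i+1}\left(1-\left(\frac{y(q-1)}{1-x^m}\right)^{p}\prod_{k=\ell}^{\ell+p-1}x^{\overline{j+kr}}\right)}}.$$
   Context: A composition of a positive integer $n$ with $d$ parts is a sequence $\pi=\pi_1\pi_2\cdots\pi_d$ of positive integers with $\pi_1+\cdots+\pi_d=n$; $\mathcal{C}_{n,d}$ is the set of compositions of $n$ with exactly $d$ parts. By convention there is one composition of $0$, the empty one, having zero parts (so $\mathcal{C}_{0,0}$ consists of the empty composition and $\mathcal{C}_{n,0}=\emptyset$ for $n\ge1$). For $m\ge 1$ and $0\le r\le m-1$, $\pi$ has an $(m,r)$-congruence succession at index $i$ ($1\le i\le d-1$) if $\pi_{i+1}\equiv \pi_i+r \pmod m$. Let $cl_{m,r}(\pi)$ be the number of $(m,r)$-congruence successions of $\pi$ (equal to $0$ for the empty composition). Define the formal power series $$R_{m,r}(x,y,q)=\sum_{n\ge0}\sum_{d=0}^n x^ny^d\left(\sum_{\pi\in\mathcal{C}_{n,d}}q^{cl_{m,r}(\pi)}\right).$$ For a positive integer $t$, $\overline{t}$ denotes the unique member of $\{1,2,\ldots,m\}$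 with $t\equiv\overline{t}\pmod m$. Empty products equal $1$. The identity is one of formal power series in $x,y$ with coefficients in $\mathbb{Z}[q]$. *)

(* Defs.v *)
From HB Require Import structures.
From mathcomp Require Import all_boot all_algebra.
From mathcomp Require Import boolp.

Set Implicit Arguments.
Unset Strict Implicit.
Unset Printing Implicit Defensive.

Import GRing.Theory.
Local Open Scope ring_scope.

Record fps (R : Type) : Type := FPS { coefs : nat -> R }.

HB.instance Definition _ (R : Type) := gen_eqMixin (fps R).
HB.instance Definition _ (R : Type) := gen_choiceMixin (fps R).

Lemma fpsP (R : Type) (f g : fps R) : coefs f =1 coefs g <-> f = g.
Proof.
split=> [fg|-> //]; case: f g fg => [f] [g] /= fg.
by congr FPS; apply/funext.
Qed.

Definition fpsC (R : nmodType) (c : R) : fps R :=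
  FPS (fun n => if n == 0%N then c else 0).

Definition fpsX (R : pzSemiRingType) : fps R := FPS (fun n => (n == 1%N)%:R).

Section FpsZmodule.
Variable R : zmodType.
Implicit Types f g h : fps R.

Definition fps_zero : fps R := FPS (fun=> 0).
Definition fps_opp f : fps R := FPS (fun n => - coefs f n).
Definition fps_add f g : fps R := FPS (fun n => coefs f n + coefs g n).

Lemma fps_addA : associative fps_add.
Proof. by move=> f g h; apply/fpsP => n /=; rewrite addrA. Qed.

Lemma fps_addC : commutative fps_add.
Proof. by move=> f g; apply/fpsP => n /=; rewrite addrC. Qed.

Lemma fps_add0 : left_id fps_zero fps_add.
Proof. by move=> f; apply/fpsP => n /=; rewrite add0r. Qed.

Lemma fps_addN : left_inverse fps_zero fps_opp fps_add.
Proof. by move=> f; apply/fpsP => n /=; rewrite addNr. Qed.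

HB.instance Definition _ := GRing.isZmodule.Build (fps R)
  fps_addA fps_addC fps_add0 fps_addN.

End FpsZmodule.

Section FpsRing.
Variable R : comNzRingType.
Implicit Types f g h : fps R.

Definition fps_mul f g : fps R :=
  FPS (fun n => \sum_(i < n.+1) coefs f i * coefs g (n - i)%N).

Definition fps_trunc N f : {poly R} := \poly_(i < N) coefs f i.

Lemma coef_fps_mul N n f g : (n < N)%N ->
  coefs (fps_mul f g) n = (fps_trunc N f * fps_trunc N g)`_n.
Proof.
move=> nN /=; rewrite coefM; apply: eq_bigr => -[i /= ile] _.
by rewrite !coef_poly (leq_ltn_trans (leq_subr _ _) nN) (leq_trans ile nN).
Qed.

Lemma fps_mulC : commutative fps_mul.
Proof.
by move=> f g; apply/fpsP => n; rewrite !(coef_fps_mul _ _ (ltnSn n)) mulrC.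
Qed.

Lemma fps_mulA : associative fps_mul.
Proof.
have H f g h n : coefs (fps_mul (fps_mul f g) h) n
    = (fps_trunc n.+1 f * fps_trunc n.+1 g * fps_trunc n.+1 h)`_n.
  rewrite [in RHS]coefM [LHS]/=; apply: eq_bigr => -[i /= ile] _.
  rewrite -(coef_fps_mul f g ile); congr (_ * _).
  by rewrite coef_poly ltnS leq_subr.
move=> f g h; apply/fpsP => n.
by rewrite fps_mulC !H mulrC mulrA.
Qed.

Lemma fps_mul1 : left_id (fpsC 1) fps_mul.
Proof.
move=> f; apply/fpsP => n /=; rewrite big_ord_recl /= mul1r subn0.
by rewrite big1 ?addr0 // => i _; rewrite mul0r.
Qed.

Lemma fps_mulDl : left_distributive fps_mul +%R.
Proof.
move=> f g h; apply/fpsP => n /=; rewrite -big_split /=.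
by apply: eq_bigr => i _; rewrite mulrDl.
Qed.

Lemma fps_oner_neq0 : fpsC 1 != 0 :> fps R.
Proof.
by apply/eqP => /fpsP/(_ 0%N)/eqP; rewrite /= oner_eq0.
Qed.

HB.instance Definition _ := GRing.Zmodule_isComNzRing.Build (fps R)
  fps_mulA fps_mulC fps_mul1 fps_mulDl fps_oner_neq0.

End FpsRing.

Section FpsUnitRing.
Variable R : comUnitRingType.
Implicit Types f g : fps R.

Definition fps_unit : {pred fps R} := [pred f | coefs f 0 \is a GRing.unit].

(* The first n.+1 coefficients of the inverse of f. *)
Fixpoint fps_inv_seq f n : seq R :=
  if n is n'.+1 then
    let s := fps_inv_seq f n' in
    rcons s (- (coefs f 0)^-1 *
               \sum_(i < n) coefs f i.+1 * s`_(n' - i))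
  else [:: (coefs f 0)^-1].

Definition fps_inv f : fps R :=
  if f \in fps_unit then FPS (fun n => (fps_inv_seq f n)`_n) else f.

Lemma size_fps_inv_seq f n : size (fps_inv_seq f n) = n.+1.
Proof. by elim: n => //= n IHn; rewrite size_rcons IHn. Qed.

Lemma nth_fps_inv_seq f n i : (i <= n)%N ->
  (fps_inv_seq f n)`_i = (fps_inv_seq f i)`_i.
Proof.
elim: n => [|n IHn]; first by case: i.
rewrite leq_eqVlt ltnS => /orP[/eqP-> //|ilen].
by rewrite /= nth_rcons size_fps_inv_seq ltnS ilen IHn.
Qed.

Lemma fps_mulV : {in fps_unit, left_inverse 1 fps_inv *%R}.
Proof.
move=> f fU; rewrite mulrC; apply/fpsP => n.
rewrite /fps_inv fU [LHS]/= big_ord_recl /= subn0.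
rewrite inE in fU; case: n => [|n] /=; first by rewrite big_ord0 addr0 mulrV.
rewrite nth_rcons size_fps_inv_seq ltnn eqxx mulrA mulrN mulrV // mulN1r.
apply/eqP; rewrite addr_eq0 eqr_opp; apply/eqP.
apply: eq_bigr => i _; rewrite /bump /= add1n subSS.
by rewrite nth_fps_inv_seq ?leq_subr.
Qed.

Lemma fps_unitPl f g : g * f = 1 -> fps_unit f.
Proof.
move/fpsP/(_ 0%N); rewrite /= big_ord1 subnn => gf1.
by apply/unitrPr; exists (coefs g 0); rewrite mulrC.
Qed.

Lemma fps_inv_out : {in [predC fps_unit], fps_inv =1 id}.
Proof. by move=> f /negPf fU; rewrite /fps_inv fU. Qed.

HB.instance Definition _ := GRing.ComNzRing_hasMulInverse.Build (fps R)
  fps_mulV fps_unitPl fps_inv_out.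

End FpsUnitRing.

(* Z[q][[x, y]] is represented as Z[q][[y]][[x]]. *)
Definition Zqxy : comUnitRingType := fps (fps {poly int}).

Definition Zq_emb (c : {poly int}) : Zqxy := fpsC (fpsC c).

Definition vx : Zqxy := fpsX (fps {poly int}).
Definition vy : Zqxy := fpsC (fpsX {poly int}).
Definition vq : Zqxy := Zq_emb 'X.

(* No part of a composition of n exceeds n, so parts can be taken in 'I_n.+1. *)
Definition compositions (n d : nat) : {set d.-tuple 'I_n.+1} :=
  [set t : d.-tuple 'I_n.+1 |
    all (fun k => 0 < k)%N (map val t) && (sumn (map val t) == n)].

(* Parts are indexed from 0. *)
Definition cl (m r : nat) (s : seq nat) : nat :=
  #|[set i : 'I_(size s).-1 | (nth 0 s i.+1 == nth 0 s i + r %[mod m])%N]|.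

(* The coefficient of x^n lies in Z[q][[y]], whose variable y is fpsX {poly int}. *)
Definition Rgf (m r : nat) : Zqxy :=
  FPS (fun n => \sum_(0 <= d < n.+1)
    fpsX {poly int} ^+ d *
    fpsC (\sum_(t in compositions n d) 'X ^+ cl m r (map val t))).

(* The representative of t modulo m in {1, ..., m}. *)
Definition resid1 (m t : nat) : nat := if (m %| t)%N then m else (t %% m)%N.

(* Main.v *)
(** Classify the nonempty compositions by the residue of their first part: let
    F a be the series of those whose first part is congruent to a mod m, and
    u a = y x^(resid1 a) / (1 - x^m) the series of the one-part ones.  Removing
    the first part gives F a = u a (R + (q - 1) F (a + r)).  Since p r = 0 mod m,
    iterating p times closes up and expresses F a as a multiple of R.  The
    residues j + l r with 1 <= j <= s and 0 <= l < p are all the residues mod m,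
    each once, so summing the F (j + l r) gives R - 1. *)
Require Import Defs.
From mathcomp Require Import all_boot all_algebra ring.

Import GRing.Theory.
Local Open Scope ring_scope.

(** * Cyclic systems of linear equations *)

(** Unrolling the recurrence [n] times leaves the remainder [H], a multiple of [F (l + n)]. At
    [n = p] periodicity makes it a multiple of [F l] itself, and the resulting linear equation is
    solved for [F l]. *)
Lemma cyclic_system_sol (A : comUnitRingType) (u F : nat -> A) (R t : A) l p :
    (forall k, F k = u k * (R + t * F k.+1)) -> F (l + p)%N = F l ->
    1 - t ^+ p * \prod_(l <= k < l + p) u k \is a GRing.unit ->
  F l = R * \sum_(0 <= i < p) (t ^+ i * \prod_(l <= k < (i + l).+1) u k) /
                              (1 - t ^+ p * \prod_(l <= k < l + p) u k).
Proof.
move=> FE Fper U.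
have H n : F l = R * (\sum_(0 <= i < n) t ^+ i * \prod_(l <= k < (i + l).+1) u k)
               + t ^+ n * (\prod_(l <= k < l + n) u k) * F (l + n)%N.
  elim: n => [|n IHn].
    by rewrite addn0 !big_geq // mulr0 add0r !mul1r.
  rewrite IHn big_nat_recr //= {1}FE (addnC n l) addnS.
  rewrite !big_nat_recr ?leq_addr //= exprS.
  set S := \sum_(_ <= _ < _) _; set P := \prod_(_ <= _ < _) _.
  ring.
rewrite -mulr_suml mulrA; apply: (canRL (mulrK U)).
by rewrite mulrBr mulr1 {1}(H p) Fper [F l * _]mulrC addrK.
Qed.

Lemma prod_scale (A : comUnitRingType) (X : nat -> A) (y z : A) l n :
  \prod_(l <= k < l + n) (y * X k / z) = (y / z) ^+ n * \prod_(l <= k < l + n) X k.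
Proof.
under eq_bigr => k _ do rewrite mulrAC.
by rewrite big_split prodr_const_nat addKn.
Qed.

(** The case [u k = y * X k / z], with powers of [y], [z] and [t] collected so that the summand has
    the shape needed in the theorem, where [t] is [vq - 1] and [z] is [1 - vx ^+ m]. *)
Lemma scaled_cyclic_system_sol (A : comUnitRingType) (X F : nat -> A)
    (R t y z : A) l p :
    z \is a GRing.unit ->
    (forall k, F k = y * X k / z * (R + t * F k.+1)) -> F (l + p)%N = F l ->
    1 - (y * t / z) ^+ p * \prod_(l <= k < l + p) X k \is a GRing.unit ->
  F l = R * \sum_(0 <= i < p)
    (X (i + l)%N * y ^+ (i + 1) * t ^+ i * \prod_(l <= k < i + l) X k) /
    (z ^+ (i + 1) * (1 - (y * t / z) ^+ p * \prod_(l <= k < l + p) X k)).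
Proof.
move=> Uz FE Fper U.
have uprod n : t ^+ n * \prod_(l <= k < l + n) (y * X k / z) =
    (y * t / z) ^+ n * \prod_(l <= k < l + n) X k.
  by rewrite prod_scale mulrA -exprMn; congr (_ ^+ _ * _); rewrite mulrCA mulrA.
rewrite (cyclic_system_sol _ _ _ _ _ _ _ FE Fper) uprod //; congr (_ * _).
apply: eq_bigr => i _; rewrite big_nat_recr ?leq_addl //= invrM ?unitrX //.
rewrite [RHS]mulrA [RHS]mulrAC; congr (_ / _).
rewrite addnC prod_scale addn1 -exprVn exprMn !exprS.
by set P := \prod_(_ <= _ < _) _; ring.
Qed.

(** * Complete residue systems modulo [m] *)

(** Since [s] divides both [m] and [r], reduction modulo [s] recovers [j]. Then [l] is determined
    modulo [p], because [r %/ s] is coprime to [p]. *)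
Lemma uniq_residues m r : (0 < m)%N ->
  uniq [seq ((j + l * r) %% m)%N | j <- index_iota 1 (gcdn m r).+1,
                                   l <- index_iota 0 (m %/ gcdn m r)].
Proof.
move=> m0; set s := gcdn m r; set p := (m %/ s)%N.
have s0 : (0 < s)%N by rewrite gcdn_gt0 m0.
have mE : m = (p * s)%N by rewrite divnK // dvdn_gcdl.
have rE : r = (r %/ s * s)%N by rewrite divnK // dvdn_gcdr.
have cop : coprime p (r %/ s).
  by rewrite /coprime -(eqn_pmul2r s0) muln_gcdl -mE -rE mul1n.
apply: allpairs_uniq; rewrite ?iota_uniq // => -[j l] [j' l'].
move=> /allpairsP[[a b] /= [ain bin [-> ->]]].
move=> /allpairsP[[a' b'] /= [ain' bin' [-> ->]]] {j l j' l'} E.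
rewrite !mem_index_iota in ain bin ain' bin'.
have Ea : a = a'.
  have : (a = a' %[mod s])%N.
    have := congr1 (modn^~ s) E.
    rewrite !modn_dvdm ?dvdn_gcdl // rE !mulnA -![(a + _)%N]addnC -![(a' + _)%N]addnC.
    by rewrite !modnMDl.
  case/andP: ain ain' => a1 a2 /andP[a1' a2'].
  (* Both numbers lie in 1..s; lowering them by one puts them in the range where reduction modulo
     [s] is the identity. *)
  rewrite -(subnK a1) -(subnK a1') => /eqP; rewrite eqn_modDr => /eqP.
  by rewrite !modn_small ?subn1 ?prednK // => ->.
congr (_, _) => //; move/eqP: E; rewrite Ea eqn_modDl.
rewrite mE rE !mulnA -!muln_modl eqn_pmul2r // => /eqP E.
wlog le : b b' bin bin' E / (b <= b')%N.
  by move=> H; case/orP: (leq_total b b') => h; [|symmetry]; apply: H.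
move/eqP: E; rewrite eq_sym eqn_mod_dvd ?leq_mul // -mulnBl Gauss_dvdl // => /eqP E.
move: bin bin' => /= bin bin'.
(* The difference [b' - b] is divisible by [p] and smaller than [p], hence zero. *)
rewrite modn_small in E; last exact: leq_ltn_trans (leq_subr _ _) bin'.
by apply/eqP; rewrite eqn_leq le -subn_eq0 E.
Qed.

(** Distinctness suffices: there are [s * p = m] values, all below [m]. *)
Lemma perm_residues m r : (0 < m)%N ->
  perm_eq [seq ((j + l * r) %% m)%N | j <- index_iota 1 (gcdn m r).+1,
                                      l <- index_iota 0 (m %/ gcdn m r)]
          (iota 0 m).
Proof.
move=> m0; have U := uniq_residues m r m0.
apply: uniq_perm => //; first exact: iota_uniq.
apply: (uniq_min_size U _ _).2.
  by move=> x /allpairsP[[a b] /= [_ _ ->]]; rewrite mem_iota /= add0n ltn_mod.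
by rewrite size_allpairs !size_iota subn0 subn1 /= mulnC divnK ?dvdn_gcdl.
Qed.

(** * Compositions as lists of natural numbers *)

(** Recursion on the first part makes its removal a computation, and the parts are free of the bound
    ['I_n.+1], which would change with [n]. *)
Fixpoint comps (n d : nat) : seq (seq nat) :=
  if d is d'.+1 then [seq k :: s | k <- index_iota 1 n.+1, s <- comps (n - k) d']
  else if n == 0%N then [:: [::]] else [::].

Lemma mem_comps n d s :
  (s \in comps n d) =
  [&& size s == d, all (fun k => 0 < k)%N s & sumn s == n].
Proof.
elim: d n s => [|d IHd] n [|k s] //=.
- by case: n.
- by case: (n == 0%N).
- by apply/allpairsPdep => -[? [? []]].
apply/allpairsPdep/idP => [[k' [s' [kin sin [-> ->]]]]|].
  move: sin kin; rewrite IHd mem_index_iota eqSS => /and3P[-> -> /eqP->].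
  by case/andP=> -> kn /=; rewrite subnKC.
rewrite eqSS => /and3P[sd /andP[k0 s0] /eqP sn].
exists k, s; split=> //.
  by rewrite mem_index_iota k0 ltnS -sn leq_addr.
by rewrite IHd sd s0 -sn addKn /=.
Qed.

Lemma uniq_comps n d : uniq (comps n d).
Proof.
elim: d n => [|d IHd] n /=; first by case: n.
apply: allpairs_uniq_dep; first exact: iota_uniq.
- by move=> k _; apply: IHd.
- by move=> [k s] [k' s'] _ _ /= [-> ->].
Qed.

Lemma comps_gt n d : (n < d)%N -> comps n d = [::].
Proof.
move=> nd; case E: (comps n d) => [//|s l].
have : s \in comps n d by rewrite E mem_head.
rewrite mem_comps => /and3P[/eqP sd s0 /eqP sn].
suff : (size s <= sumn s)%N by rewrite sd sn leqNgt nd.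
elim: s s0 {E sd sn l} => //= k s IHs /andP[k0 s0].
by rewrite -add1n leq_add // IHs.
Qed.

Lemma perm_compositions n d :
  perm_eq [seq map val (t : d.-tuple 'I_n.+1) | t in compositions n d]
          (comps n d).
Proof.
apply: uniq_perm; last move=> s; rewrite ?uniq_comps //.
  rewrite map_inj_in_uniq ?enum_uniq // => t t' _ _.
  by move/(inj_map val_inj)/val_inj.
rewrite mem_comps; apply/imageP/idP => [[t]|].
  by rewrite inE => /andP[t0 tn] ->; rewrite size_map size_tuple eqxx t0 tn.
move=> /and3P[/eqP sd s0 /eqP sn].
have lt k : k \in s -> (k < n.+1)%N.
  move=> ks; rewrite ltnS -sn; elim: s ks {sd s0 sn} => //= h s IHs.
  rewrite inE => /orP[/eqP->|/IHs]; first exact: leq_addr.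
  by move/leq_trans; apply; apply: leq_addl.
(* No part exceeds the sum [n], so [inord] never falls back on its default value. *)
have tE : map val (map (@inord n) s) = s.
  rewrite -map_comp -[RHS]map_id; apply/eq_in_map => k ks /=.
  by rewrite inordK // lt.
have st : size (map (@inord n) s) == d by rewrite size_map sd.
exists (Tuple st); last by rewrite /= tE.
by rewrite inE /= tE s0 sn eqxx.
Qed.

(** * Coefficient extraction and invertibility for power series *)

Lemma coefs_sum (R : zmodType) I (l : seq I) (P : pred I) (G : I -> fps R) n :
  coefs (\sum_(i <- l | P i) G i) n = \sum_(i <- l | P i) coefs (G i) n.
Proof. by elim/big_rec2: _ => //= i x y _ <-. Qed.

Lemma fpsC_sum (R : zmodType) I (l : seq I) (P : pred I) (G : I -> R) :
  fpsC (\sum_(i <- l | P i) G i) = \sum_(i <- l | P i) fpsC (G i).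
Proof.
apply/fpsP => n; rewrite coefs_sum /=.
by case: (n == 0%N); last rewrite big1.
Qed.

Lemma fpsCM (R : comNzRingType) (a : R) (f : fps R) n :
  coefs (fpsC a * f) n = a * coefs f n.
Proof.
rewrite [LHS]big_ord_recl /= subn0 big1 ?addr0 // => i _.
by rewrite mul0r.
Qed.

Lemma fpsC_mul (R : comNzRingType) (a b : R) : fpsC (a * b) = fpsC a * fpsC b.
Proof.
apply/fpsP => n; rewrite fpsCM /=.
by case: (n == 0%N); rewrite ?mulr0.
Qed.

Lemma coefs_fpsXnM (R : comNzRingType) (f : fps R) m n :
  coefs (fpsX R ^+ m * f) n = if (n < m)%N then 0 else coefs f (n - m)%N.
Proof.
elim: m f n => [|m IHm] f n; first by rewrite mul1r subn0.
rewrite exprSr -mulrA IHm.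
have XM g k : coefs (fpsX R * g) k = if k is k'.+1 then coefs g k' else 0.
  rewrite [LHS]big_ord_recl /= mul0r add0r; case: k => [|k]; first by rewrite big_ord0.
  rewrite big_ord_recl /= mul1r subn1 /= big1 ?addr0 // => i _.
  by rewrite mul0r.
rewrite XM; case: (ltngtP n m) => [nm|mn|->].
- by rewrite ltnS ltnW.
- by rewrite ltnNge mn subnS; case: (n - m)%N (subn_gt0 m n) mn => // <-.
- by rewrite ltnSn subnn.
Qed.

Lemma coefs0M (R : comNzRingType) (f g : fps R) :
  coefs (f * g) 0 = coefs f 0 * coefs g 0.
Proof. by rewrite [LHS]big_ord1. Qed.

Lemma coefs0_fpsXn (R : comNzRingType) n : (0 < n)%N -> coefs (fpsX R ^+ n) 0 = 0.
Proof. by move=> n0; rewrite -[_ ^+ n]mulr1 coefs_fpsXnM n0. Qed.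

Lemma unit_1sub (R : comUnitRingType) (f : fps R) :
  coefs f 0 = 0 -> 1 - f \is a GRing.unit.
Proof.
move=> f0; suff : fps_unit (1 - f) by [].
by rewrite /fps_unit inE /= f0 subr0 unitr1.
Qed.

(** * The recurrence obtained by removing the first part *)

Section Recurrence.

Variables m r : nat.
Hypothesis m_gt0 : (0 < m)%N.

Let Y : fps {poly int} := fpsX {poly int}.
Let Q : fps {poly int} := fpsC 'X.

Definition weight (s : seq nat) : fps {poly int} := Y ^+ size s * Q ^+ cl m r s.

(** The empty list is excluded explicitly, as the default head 0 would place it in the class of
    0. *)
Definition starts (a : nat) (s : seq nat) : bool :=
  (s != [::]) && (head 0%N s == a %[mod m])%N.

Definition Fgf (a : nat) : Zqxy :=
  FPS (fun n => \sum_(0 <= d < n.+1) \sum_(s <- comps n d | starts a s) weight s).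

(** The series [u a] of the one-part compositions, given by its coefficients; [part_gfE] gives the
    closed form. *)
Definition part_gf (a : nat) : Zqxy :=
  FPS (fun k => if (0 < k)%N && (k == a %[mod m])%N then Y else 0).

Lemma cl_cons k s : cl m r (k :: s) = (starts (k + r) s + cl m r s)%N.
Proof.
have clE t : cl m r t =
    (\sum_(i < (size t).-1) (nth 0 t i.+1 == nth 0 t i + r %[mod m]))%N.
  by rewrite /cl -sum1_card big_mkcond; apply: eq_bigr => i _; rewrite inE; case: eqP.
rewrite !clE; case: s => [|h s] /=; first by rewrite !big_ord0.
by rewrite big_ord_recl.
Qed.

(** A new succession multiplies the weight by q = 1 + (q - 1). Summed over [s], the 1 yields the
    term in R and the q - 1 the term in F. *)
Lemma weight_cons k s :
  weight (k :: s) = Y * (weight s + (Q - 1) * (if starts (k + r) s then weight s else 0)).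
Proof.
rewrite /weight cl_cons exprS exprD -mulrA; congr (_ * _).
case: (starts _ _); last by rewrite mul1r mulr0 addr0.
by rewrite mulrBl mul1r addrC subrK mulrCA.
Qed.

Lemma coefs_Rgf n :
  coefs (Rgf m r) n = \sum_(0 <= d < n.+1) \sum_(s <- comps n d) weight s.
Proof.
apply: eq_bigr => d _; rewrite -(perm_big _ (perm_compositions n d)) /=.
rewrite big_image /= fpsC_sum mulr_sumr.
apply: eq_bigr => t _; rewrite /weight size_map size_tuple; congr (_ * _).
elim: (cl _ _ _) => [//|c IHc]; by rewrite !exprS fpsC_mul IHc.
Qed.

(** Removing a part [k] lowers the sum to [n - k] but leaves the range of [d] too long; the extra
    terms are empty by [comps_gt]. *)
Lemma sum_comps_widen n N (P : pred (seq nat)) : (n <= N)%N ->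
  \sum_(0 <= d < N.+1) \sum_(s <- comps n d | P s) weight s =
  \sum_(0 <= d < n.+1) \sum_(s <- comps n d | P s) weight s.
Proof.
move=> nN; rewrite (@big_cat_nat _ _ _ n.+1) //= -[RHS]addr0; congr (_ + _).
rewrite big_nat big1 // => d /andP[nd _].
by rewrite comps_gt ?big_nil.
Qed.

Lemma starts_modl a b s : (a = b %[mod m])%N -> starts a s = starts b s.
Proof. by rewrite /starts => ->. Qed.

Lemma sum_weight_cons n k d :
  \sum_(s <- comps n d) weight (k :: s) =
  Y * (\sum_(s <- comps n d) weight s +
       (Q - 1) * \sum_(s <- comps n d | starts (k + r) s) weight s).
Proof.
rewrite [X in (Q - 1) * X]big_mkcond /= !mulr_sumr -big_split /= mulr_sumr.
by apply: eq_bigr => s _; rewrite weight_cons.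
Qed.

Lemma coefs_Fgf a n :
  coefs (Fgf a) n = \sum_(1 <= k < n.+1 | (k == a %[mod m])%N)
    Y * (coefs (Rgf m r) (n - k) + (Q - 1) * coefs (Fgf (a + r)) (n - k)).
Proof.
(* The term [d = 0] vanishes: its only possible list is empty, and [starts] rejects it. *)
rewrite [LHS]/= big_nat_recl // [X in X + _]big_seq_cond big1 ?add0r; last first.
  by move=> s /andP[]; rewrite mem_comps => /and3P[/nilP-> _ _].
under eq_bigr => d _ do rewrite big_mkcond big_allpairs_dep /=.
rewrite exchange_big [LHS]/= [RHS]big_mkcond; apply: eq_big_nat => k /andP[k0 kn].
rewrite /starts [LHS]/=; case: eqP => [ka|_]; last by rewrite big1 // => d _; rewrite big1.
under eq_bigr => d _ do rewrite sum_weight_cons.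
rewrite -mulr_sumr big_split [LHS]/= -mulr_sumr coefs_Rgf [coefs (Fgf _) _]/=.
case: n kn => [|n] kn; first by case: k k0 kn {ka}.
have nk : (n.+1 - k <= n)%N by rewrite leq_subLR -(prednK k0) addSn ltnS leq_addl.
rewrite !(sum_comps_widen _ _ _ nk).
do 3![congr (_ * _) || congr (_ + _)]; apply: eq_bigr => d _; apply: eq_bigl => s.
by apply: starts_modl; apply/eqP; rewrite eqn_modDr; apply/eqP.
Qed.

Lemma Fgf_rec a : Fgf a = part_gf a * (Rgf m r + (vq - 1) * Fgf (a + r)).
Proof.
apply/fpsP => n.
have vqM f i : coefs ((vq - 1) * f) i = (Q - 1) * coefs f i.
  by rewrite mulrBl mul1r mulrBl mul1r -fpsCM.
rewrite coefs_Fgf [RHS]/= -(big_mkord xpredT (fun i => coefs (part_gf a) i *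
  coefs (Rgf m r + (vq - 1) * Fgf (a + r)) (n - i))).
(* The convolution starts at index 0, where [part_gf a] vanishes because parts are positive. *)
rewrite big_nat_recl // [X in X * _]/= mul0r add0r big_add1 big_mkcond.
apply: eq_bigr => k _; rewrite [coefs (part_gf a) _]/=.
by case: eqP => _; [rewrite -vqM | rewrite mul0r].
Qed.

Lemma Fgf_modl a b : (a = b %[mod m])%N -> Fgf a = Fgf b.
Proof.
move=> ab; apply/fpsP => n; apply: eq_bigr => d _.
by apply: eq_bigl => s; apply: starts_modl.
Qed.

(** By [perm_residues], exactly one pair [(j, l)] matches the residue of the head of a nonempty
    list. *)
Lemma sum_starts s :
  \sum_(1 <= j < (gcdn m r).+1) \sum_(0 <= l < m %/ gcdn m r)
     (if starts (j + l * r) s then weight s else 0) =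
  if s is [::] then 0 else weight s.
Proof.
case: s => [|h s]; first by rewrite big1 // => j _; rewrite big1.
transitivity (\sum_(a <- [seq ((j + l * r) %% m)%N |
    j <- index_iota 1 (gcdn m r).+1, l <- index_iota 0 (m %/ gcdn m r)])
    (if starts a (h :: s) then weight (h :: s) else 0)).
  rewrite big_allpairs_dep; apply: eq_bigr => j _; apply: eq_bigr => l _.
  by rewrite (starts_modl ((j + l * r) %% m) (j + l * r)) ?modn_mod.
rewrite (perm_big _ (perm_residues m r m_gt0)) /=.
have hm : (h %% m)%N \in iota 0 m by rewrite mem_iota /= add0n ltn_mod.
rewrite (bigD1_seq _ hm) ?iota_uniq //= /starts /= modn_mod eqxx.
rewrite big_seq_cond big1 ?addr0 // => a.
rewrite mem_iota /= add0n => /andP[am ah].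
by rewrite (modn_small am) eq_sym (negPf ah).
Qed.

Lemma Rgf_sum : Rgf m r = 1 +
  \sum_(1 <= j < (gcdn m r).+1) \sum_(0 <= l < m %/ gcdn m r) Fgf (j + l * r).
Proof.
apply/fpsP => n; rewrite coefs_Rgf [RHS]/= coefs_sum.
under [X in _ + X]eq_bigr => j _ do (rewrite coefs_sum;
  under eq_bigr => l _ do (rewrite /=;
    under eq_bigr => d _ do rewrite big_mkcond)).
under [X in _ + X]eq_bigr => j _ do rewrite exchange_big.
(* The term [d = 0] is split off on both sides: the empty composition accounts for the summand 1. *)
rewrite exchange_big [RHS]/= [LHS]big_nat_recl // [X in _ = _ + X]big_nat_recl //.
rewrite addrA; congr (_ + _).
  rewrite [comps n 0]/=; case: (n == 0%N); last first.
    by rewrite big_nil add0r big1 // => j _; rewrite big1 // => l _; rewrite big_nil.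
  rewrite big_seq1 {1}/weight /cl eq_card0 ?mul1r; last by case.
  rewrite big1 ?addr0 // => j _; rewrite big1 // => l _; exact: big_seq1.
apply: eq_bigr => d _; under [RHS]eq_bigr => j _ do rewrite exchange_big.
rewrite [RHS]exchange_big [LHS]big_seq [RHS]big_seq; apply: eq_bigr => s sd.
rewrite sum_starts; case: s sd => [|//]; by rewrite mem_comps.
Qed.

(** Multiplying by [1 - vx ^+ m] subtracts the coefficient at [n - m] from that at [n], so only the
    least positive exponent congruent to [a] survives. *)
Lemma part_gfE a : (0 < a)%N -> part_gf a = vy * vx ^+ resid1 m a / (1 - vx ^+ m).
Proof.
move=> a0; have U : 1 - vx ^+ m \is a GRing.unit by apply/unit_1sub/coefs0_fpsXn.
apply: (canRL (mulrK U)); apply/fpsP => n.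
rewrite mulrBr mulr1 [_ * vx ^+ m]mulrC [vy * _]mulrC.
rewrite (coefs_fpsXnM _ vy (resid1 m a) n).
transitivity (coefs (part_gf a) n - coefs (vx ^+ m * part_gf a) n); first by [].
rewrite (coefs_fpsXnM _ (part_gf a) m n) /= /resid1 /dvdn.
(* Below [m] nothing is subtracted, and above [m] the two coefficients agree. At [n = m] the index
   [n - m] is 0, which is not a part, so the coefficient survives exactly when [m] divides [a];
   hence the representative [m] instead of 0. *)
case: (ltngtP n m) => [nm|mn|->].
- rewrite (modn_small nm) subr0; case: (posnP (a %% m)) => [->|am].
    by rewrite eqn0Ngt andbN nm.
  case: (ltngtP n (a %% m)) => [|am'|->]; rewrite ?andbF //.
  + by rewrite subn_eq0 leqNgt am'.
  + by rewrite am subnn.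
- rewrite subn_gt0 mn (ltn_trans m_gt0 mn).
  have -> : (n == a %[mod m])%N = (n - m == a %[mod m])%N.
    by rewrite -{1}(subnK (ltnW mn)) modnDr.
  rewrite subrr; have rm : ((if a %% m == 0 then m else a %% m) < n)%N.
    by case: ifP => // _; apply: ltn_trans mn; rewrite ltn_mod.
  by case: ltnP => // _; rewrite subn_eq0 leqNgt rm.
- rewrite subnn ltnn subr0 m_gt0 modnn [(0 == _)%N]eq_sym /=.
  case: eqP => [_|/eqP am]; first by rewrite ltnn subnn.
  by rewrite ltnNge (ltnW _) ?ltn_mod //= subn_eq0 leqNgt ltn_mod m_gt0.
Qed.

End Recurrence.

(** * Solving for the generating function *)

Theorem theorem2 (m r : nat) (hm : (1 <= m)%N) (hr : (r <= m - 1)%N) :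
  let s := gcdn m r in
  let p := (m %/ s)%N in
  Rgf m r =
    1 / (1 - \sum_(1 <= j < s.+1) \sum_(0 <= l < p) \sum_(0 <= i < p)
      (vx ^+ resid1 m (j + (i + l) * r) * vy ^+ (i + 1) * (vq - 1) ^+ i *
         \prod_(l <= k < i + l) vx ^+ resid1 m (j + k * r)) /
      ((1 - vx ^+ m) ^+ (i + 1) *
         (1 - (vy * (vq - 1) / (1 - vx ^+ m)) ^+ p *
            \prod_(l <= k < l + p) vx ^+ resid1 m (j + k * r)))).
Proof.
move=> s p.
have s0 : (0 < s)%N by rewrite gcdn_gt0 hm.
have sm : (s %| m)%N by apply: dvdn_gcdl.
have p0 : (0 < p)%N by rewrite divn_gt0 // dvdn_leq.
have xm0 : coefs (vx ^+ m) 0 = 0 by apply: coefs0_fpsXn.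
have xr0 a : coefs (vx ^+ resid1 m a) 0 = 0.
  apply: coefs0_fpsXn; rewrite /resid1; case: ifP => // /negbT.
  by rewrite lt0n.
set T := 1 - vx ^+ m; have UT : T \is a GRing.unit by apply: unit_1sub.
set S := \sum_(1 <= j < _) _.
(* Each summand contains a positive power of [vx], so [1 - S] is invertible and the claim becomes R
   = 1 + R S. *)
have S0 : coefs S 0 = 0.
  rewrite /S coefs_sum big1 // => j _; rewrite coefs_sum big1 // => l _.
  rewrite coefs_sum big1 // => i _.
  by rewrite !coefs0M xr0 !mul0r.
apply: (canRL (mulrK (unit_1sub _ _ S0))).
suff E : Rgf m r = 1 + Rgf m r * S by rewrite mulrBr mulr1 {1}E addrK.
rewrite {1}Rgf_sum // mulr_sumr; congr (_ + _).
rewrite [LHS]big_nat [RHS]big_nat; apply: eq_bigr => j /andP[j0 _].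
rewrite mulr_sumr; apply: eq_bigr => l _.
(* For fixed [j], raising [k] by one adds [r] to the residue, so the recurrence of [Fgf] becomes a
   system indexed by [k]. *)
apply: (scaled_cyclic_system_sol _ (fun k => vx ^+ resid1 m (j + k * r))
  (fun k => Fgf m r (j + k * r))) => // [k||].
- rewrite Fgf_rec // part_gfE ?addn_gt0 ?j0 //.
  by rewrite mulSn [(r + _)%N]addnC addnA.
(* The period is [p]: since [m = p * s] and [s] divides [r], [m] divides [p * r]. *)
- apply: Fgf_modl; rewrite mulnDl addnA.
  suff /dvdnP[c ->] : (m %| p * r)%N by rewrite addnC modnMDl.
  by rewrite -{1}(divnK sm) dvdn_pmul2l // dvdn_gcdr.
(* As [p] is positive, the product has a first factor, whose constant coefficient in x is zero. *)
apply: unit_1sub; rewrite coefs0M; case: (p) p0 => // n _.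
by rewrite addnS big_nat_recl ?leq_addr // coefs0M xr0 mul0r mulr0.
Qed.
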